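(* Let $\alpha_0=\dfrac{\Vert H\chi_{(0,1)}\Vert_{\mathrm{BMO}}}{\Vert \chi_{(0,1)}\Vert_{\mathrm{BMO}}}$. For every nonincreasing locally integrable function $f$ on $\mathbb{R}_+=(0,\infty)$, $$\Vert Hf\Vert_{\mathrm{BMO}}\geq \alpha_0\,\Vert f\Vert_{\mathrm{BMO}}.$$ The constant $\alpha_0$ is optimal, i.e. the inequality fails in general if $\alpha_0$ is replaced by any larger constant. More explicitly, if $\gamma_1>1$ is the nontrivial solution (the solution in $(1,\infty)$) of $$\log\!\left(\frac{\gamma}{1+\log\gamma}\right)=\frac{\log\gamma}{1+\log\gamma},$$ then $$\alpha_0=\frac{4\log\gamma_1}{\gamma_1(1+\log\gamma_1)}\approx 0.52123637 .$$
   Context: $\mathbb{R}_+=(0,\infty)$. Functions are real valued, and ''locally integrable on $\mathbb{R}_+$'' means integrable on every bounded interval $I\subset\mathbb{R}_+$, including the intervals $(0,t)$, $t>0$. The Hardy operator is $Hf(x)=\frac1x\int_0^x f(t)\,dt$, $x>0$. For a bounded interval $I\subset\mathbb{R}_+$, $f_I=\frac1{|I|}\int_I f$, $\Omega(f;I)=\frac1{|I|}\int_I|f(x)-f_I|\,dx$, and $\Vert f\Vert_{\mathrm{BMO}}=\sup_{I\subset\mathbb{R}_+}\Omega(f;I)\in[0,\infty]$, the supremum being over all bounded intervals $I\subset \mathbb{R}_+$; if a function fails to be integrable on some bounded interval $I\subset\mathbb{R}_+$, its BMO seminorm is understood to be $+\infty$. $\chi_{(0,1)}$ is the indicator function of 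$(0,1)$.
   Formalization: The printed decimal 0.52123637 is off by one in its last digit (the constant is 0.5212363828..., which rounds to 0.52123638), so ''≈'' is rendered as: the constant differs from 0.52123637 by less than 2·10^-8. *)

(* Defs.v *)
From HB Require Import structures.
From mathcomp Require Export all_boot all_order all_algebra.
From mathcomp Require Export all_classical all_reals all_analysis.
Export Order.TTheory GRing.Theory Num.Theory.
Export numFieldNormedType.Exports.

#[export] Set Implicit Arguments.
#[export] Unset Strict Implicit.
#[export] Unset Printing Implicit Defensive.

Local Open Scope classical_set_scope.
Local Open Scope ring_scope.

(* Functions on (0, +oo) are encoded as total functions R -> R; no definition
   below depends on the values at nonpositive arguments. *)

(* Only nondegenerate intervals, so that 1 / |I| makes sense. Intervals may be
   open, closed or half-open, and may have 0 as left endpoint. *)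
Definition bounded_interval_pos (R : realType) (I : set R) : Prop :=
  [/\ is_interval I, bounded_set I, I `<=` [set x | 0 < x]
    & (0 < @lebesgue_measure R I)%E].

(* Stronger than the library's [locally_integrable], which only looks at compact
   subsets: here integrability on (0, t) is required as well. *)
Definition loc_integrable_pos (R : realType) (f : R -> R) : Prop :=
  forall I : set R, bounded_interval_pos I ->
    (@lebesgue_measure R).-integrable I (EFin \o f).

Definition hardy (R : realType) (f : R -> R) (x : R) : R :=
  x^-1 * \int[@lebesgue_measure R]_(t in `]0, x[) f t.

Definition average (R : realType) (f : R -> R) (I : set R) : R :=
  (fine (@lebesgue_measure R I))^-1 * \int[@lebesgue_measure R]_(t in I) f t.

Definition mean_osc (R : realType) (f : R -> R) (I : set R) : R :=
  average (fun x => `|f x - average f I|) I.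

Definition bmo (R : realType) (f : R -> R) : \bar R :=
  if `[< loc_integrable_pos f >]
  then ereal_sup [set (mean_osc f I)%:E | I in @bounded_interval_pos R]
  else +oo%E.

Definition chi01 (R : realType) : R -> R := \1_(`]0, 1[%classic : set R).

Definition alpha0 (R : realType) : \bar R :=
  (bmo (hardy (@chi01 R)) / bmo (@chi01 R))%E.

Definition gamma_eq (R : realType) (g : R) : Prop :=
  ln (g / (1 + ln g)) = ln g / (1 + ln g).

(* Main.v *)
Require Import Defs.
From mathcomp Require Import ring lra.
Local Open Scope classical_set_scope.
Local Open Scope ring_scope.

(** For a nonincreasing function [f] the primitive [F x = \int_0^x f] is concave,
    and the BMO seminorm of [f] is twice the supremum of
    [(s / t) * (hardy f s - hardy f t)] over [0 < s < t]: the inequality [>=]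
    holds for every function ([mean_osc_ge]), and [<=] because an interval
    [(a, b)] can be replaced by an interval [(0, t)] with at least the same
    oscillation ([mean_osc_le]). As [hardy f] is nonincreasing too, the theorem
    compares such suprema for [f] and for [hardy f].

    Given [s < t], put [m = max (s, t / 2)], [u = expR (b / (1 + b)) * m] and
    [v = expR b * m], where [b = ln gamma1]. Then
    [(u / v) * (hardy (hardy f) u - hardy (hardy f) v)] is at least [alpha0] times
    [(s / t) * (hardy f s - hardy f t)] ([hardy2_ge_osc]). Both sides are linear
    in [F] and vanish on linear functions, and a concave [F] is a superposition
    of functions [min (x, c)] and a linear one, so this is an inequality for the
    indicators of [(0, c)], where it is an equality at [c = s = m], [t = 2 m]. The
    proof below avoids the superposition and compares [F] with chords
    ([log_part], [hardy2_ge]).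

    For the indicator of [(0, 1)] everything is explicit. Its BMO seminorm is
    [1 / 2], and the oscillations of [min (1, 1 / x)] lead to the maximum of
    [(y - ln (1 + y)) * expR (- y)], attained at the root [b] of
    [b - ln (1 + b) = b / (1 + b)], which is the equation of [gamma1 = expR b]
    ([bmo_chi01], [bmo_hardy_chi01]). The indicator also shows that the
    constant is optimal. The decimals come from rational enclosures of the root
    and of the exponential by Taylor polynomials. *)

Section HardyBMO.
Context {R : realType}.
Notation mu := (@lebesgue_measure R).
Implicit Types (f : R -> R) (I : set R).

(** * Intervals and mean oscillations *)

Lemma bounded_interval_pos_oo (x y : R) :
  0 <= x -> x < y -> bounded_interval_pos `]x, y[.
Proof.
move=> x0 xy; split.
- exact: interval_is_interval.
- exists y; split; first exact: num_real.
  move=> M yM z /=; rewrite in_itv /= => /andP[xz zy].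
  by rewrite ger0_norm ?(le_trans x0 (ltW xz))// (le_trans (ltW zy) (ltW yM)).
- by move=> z /=; rewrite in_itv /= => /andP[+ _]; exact: le_lt_trans.
- by rewrite lebesgue_measure_itv /= lte_fin xy -EFinB lte_fin subr_gt0.
Qed.

Lemma bounded_interval_pos_measurable I : bounded_interval_pos I -> measurable I.
Proof. by case=> /is_intervalP -> _ _ _; exact: measurable_itv. Qed.

Lemma bounded_interval_pos_sub I : bounded_interval_pos I ->
  exists2 N : R, 0 < N & I `<=` `]0, N[.
Proof.
case=> _ [M [_ IM]] Ipos _; have {}IM := IM (M + 1) (ltr_pwDr ltr01 (lexx M)).
exists (`|M| + 2); first by have := normr_ge0 M; lra.
move=> x Ix; have := IM x Ix; have := Ipos x Ix => /= x0; rewrite gtr0_norm// => xM.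
by rewrite in_itv /= x0 /=; have := ler_norm M; lra.
Qed.

Lemma loc_integrable_oo f (x y : R) : loc_integrable_pos f -> 0 <= x ->
  mu.-integrable `]x, y[ (EFin \o f).
Proof.
move=> fi x0; have [xy|yx] := ltP x y; first exact/fi/bounded_interval_pos_oo.
rewrite set_itv_ge ?bnd_simp -?leNgt//; exact: integrable_set0.
Qed.

Lemma fine_measure_oo (x y : R) : x <= y -> fine (mu `]x, y[) = y - x.
Proof.
rewrite le_eqVlt => /predU1P[->|xy]; rewrite lebesgue_measure_itv /= lte_fin.
  by rewrite ltxx subrr.
by rewrite xy.
Qed.

Lemma integrable_cst_oo (c x y : R) : mu.-integrable `]x, y[ (EFin \o cst c).
Proof.
apply: (@integrableS _ _ _ mu `[x, y]) => //; first exact: subset_itv_oo_cc.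
apply: continuous_compact_integrable; first exact: segment_compact.
by apply: continuous_subspaceT => z; exact: cvg_cst.
Qed.

Lemma Rintegral_cst_oo (c x y : R) : x <= y ->
  \int[mu]_(t in `]x, y[) c = c * (y - x).
Proof. by move=> xy; rewrite Rintegral_cst// fine_measure_oo. Qed.

Lemma Rintegral_oo_split f (x y z : R) : x <= y -> y <= z ->
  mu.-integrable `]x, z[ (EFin \o f) ->
  \int[mu]_(t in `]x, z[) f t =
  \int[mu]_(t in `]x, y[) f t + \int[mu]_(t in `]y, z[) f t.
Proof.
move=> xy; rewrite le_eqVlt => /predU1P[<- _|yz fi].
  by rewrite [in X in _ + X]set_itvoo0 Rintegral_set0 addr0.
rewrite -(@Rintegral_itvB _ f (BRight x) (BLeft z) y)// ?bnd_simp//.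
rewrite -Rintegral_itv_bndo_bndc ?subrKC// .
apply: integrableS fi => //; apply: subset_itvl; rewrite bnd_simp; exact: ltW.
Qed.

(** An interval of positive length differs from its interior by at most two
    points, which no integral sees. *)
Lemma bounded_interval_pos_endpoints I : bounded_interval_pos I ->
  exists a b, [/\ 0 <= a, a < b, `]a, b[ `<=` I &
    forall f, mu.-integrable I (EFin \o f) ->
      average f I = average f `]a, b[].
Proof.
move=> [Iitv Ibnd Ipos Imes].
have [i iE] : exists i : interval R, I = [set` i].
  by exists (Rhull I); apply/is_intervalP.
rewrite {}iE in Iitv Ibnd Ipos Imes *.
have [z Iz] : exists z, [set` i] z.
  apply: contrapT => /forallNP I0; move: Imes.
  by rewrite (_ : [set` i] = set0) ?measure0 ?ltxx//; apply/seteqP; split.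
(* positivity excludes an infinite left end, boundedness an infinite right one *)
case: i Iitv Ibnd Ipos Imes Iz => [[la a|lb] rb] Iitv Ibnd Ipos Imes Iz; last first.
  have /Ipos /= : [set` Interval (BInfty R lb) rb] (Num.min z 0).
    case: lb Iz {Iitv Ibnd Ipos Imes}; case: rb => [[] b|[]];
    rewrite /= ?in_itv //= !gt_min || rewrite /= ?in_itv //= !ge_min;
     by move=> ->.
  by rewrite lt_min ltxx andbF.
case: rb Iitv Ibnd Ipos Imes Iz => [lb b|rb] Iitv Ibnd Ipos Imes Iz; last first.
  have [M [_ /(_ (M + 1))]] := Ibnd; rewrite ltrDl => /(_ ltr01) HM.
  have /HM : [set` Interval (BSide la a) (BInfty R rb)] (Num.max z (M + 1 + 1)).
    case: la rb Iz {Iitv Ibnd Ipos Imes HM} => -[];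
    by rewrite /= !in_itv /= ?andbT ?andbF // ?le_max ?lt_max => ->.
  by move=> /ler_normlW; rewrite ge_max gerDl ler10 andbF.
have ab : a < b.
  move: Imes; rewrite lebesgue_measure_itv /= lte_fin.
  by case: (ltP a b) => // _; rewrite ltxx.
have sub : `]a, b[ `<=` [set` Interval (BSide la a) (BSide lb b)].
  by apply: subset_itv; rewrite bnd_simp; case: (la) (lb) => -[].
exists a, b; split => //.
  rewrite leNgt; apply/negP => a0.
  pose c := Num.min (a / 2) ((a + b) / 2).
  have /sub/Ipos /= : `]a, b[%classic c.
    by rewrite /= in_itv /= /c lt_min gt_min; apply/andP; split;
      [apply/andP; split|apply/orP; right]; lra.
  by apply/negP; rewrite -leNgt /c ge_min; apply/orP; left; lra.
move=> f fi; rewrite /average; congr (_ * _).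
  congr (fine _)^-1; rewrite !lebesgue_measure_itv //=.
have fi1 : mu.-integrable [set` Interval (BRight a) (BSide lb b)] (EFin \o f).
  apply: integrableS fi => //; apply: subset_itvr.
  by rewrite bnd_simp; case: (la).
have -> : \int[mu]_(t in [set` Interval (BSide la a) (BSide lb b)]) f t =
    \int[mu]_(t in [set` Interval (BRight a) (BSide lb b)]) f t.
  by case: la {Iitv Ibnd Ipos Imes Iz fi sub} => //; rewrite Rintegral_itv_obnd_cbnd.
case: lb {Iitv Ibnd Ipos Imes Iz fi sub} fi1 => // fi1.
rewrite Rintegral_itv_bndo_bndc //.
by apply: integrableS fi1 => //; apply: subset_itvl; rewrite bnd_simp.
Qed.

Lemma average_oo f (x y : R) : x <= y ->
  average f `]x, y[ = (y - x)^-1 * \int[mu]_(t in `]x, y[) f t.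
Proof. by move=> xy; rewrite /average fine_measure_oo. Qed.

Lemma mean_osc_oo f (x y : R) : x <= y -> mean_osc f `]x, y[ =
  (y - x)^-1 * \int[mu]_(t in `]x, y[) `|f t - average f `]x, y[ |.
Proof. exact: average_oo. Qed.

Lemma integrable_dist I f (c : R) : measurable I ->
  mu.-integrable I (EFin \o f) -> mu.-integrable I (EFin \o cst c) ->
  mu.-integrable I (EFin \o (fun t => `|f t - c|)).
Proof.
move=> mI fi ci; rewrite (_ : EFin \o _ = abse \o ((EFin \o f) \- (EFin \o cst c))%E)//.
by apply: integrable_abse => //; exact: integrableB.
Qed.

Lemma mean_osc_endpoints f I : loc_integrable_pos f -> bounded_interval_pos I ->
  exists a b, [/\ 0 <= a, a < b & mean_osc f I = mean_osc f `]a, b[].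
Proof.
move=> fi HI; have [a [b [a0 ab sub aE]]] := bounded_interval_pos_endpoints HI.
have mI := bounded_interval_pos_measurable HI.
have ci : mu.-integrable I (EFin \o cst (average f I)).
  have [N _ IN] := bounded_interval_pos_sub HI.
  by apply: (@integrableS _ _ _ mu `]0, N[) => //; exact: integrable_cst_oo.
exists a, b; split; [exact: a0|exact: ab|]; rewrite /mean_osc aE; last exact/integrable_dist/ci/fi.
by rewrite (aE f)//; exact: fi.
Qed.

(** * Primitives and the Hardy operator *)

Definition prim f (x : R) : R := \int[mu]_(t in `]0, x[) f t.

Lemma prim0 f : prim f 0 = 0.
Proof. by rewrite /prim set_itvoo0 Rintegral_set0. Qed.

Lemma primE f (x : R) : 0 < x -> prim f x = x * hardy f x.
Proof. by move=> x0; rewrite /hardy mulVKf// gt_eqF. Qed.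

Lemma Rintegral_prim f (x y : R) : loc_integrable_pos f -> 0 <= x -> x <= y ->
  \int[mu]_(t in `]x, y[) f t = prim f y - prim f x.
Proof.
move=> fi x0 xy; have i0y := loc_integrable_oo y fi (lexx 0).
by rewrite /prim (Rintegral_oo_split x0 xy i0y) addrAC subrr add0r.
Qed.

Lemma le_prim_sub f (x y c : R) : loc_integrable_pos f -> 0 <= x -> x <= y ->
  (forall t, x < t -> t < y -> f t <= c) -> prim f y - prim f x <= c * (y - x).
Proof.
move=> fi x0 xy fc; rewrite -Rintegral_prim// -Rintegral_cst_oo//.
apply: le_Rintegral => //; [exact: loc_integrable_oo|exact: integrable_cst_oo|].
by move=> t /=; rewrite in_itv /= => /andP[]; exact: fc.
Qed.

Lemma ge_prim_sub f (x y c : R) : loc_integrable_pos f -> 0 <= x -> x <= y ->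
  (forall t, x < t -> t < y -> c <= f t) -> c * (y - x) <= prim f y - prim f x.
Proof.
move=> fi x0 xy fc; rewrite -Rintegral_prim// -Rintegral_cst_oo//.
apply: le_Rintegral => //; [exact: integrable_cst_oo|exact: loc_integrable_oo|].
by move=> t /=; rewrite in_itv /= => /andP[]; exact: fc.
Qed.

Lemma integrable_sub_cst_oo f (x y c : R) : loc_integrable_pos f -> 0 <= x ->
  mu.-integrable `]x, y[ (EFin \o (fun t => f t - c)).
Proof.
move=> fi x0; rewrite (_ : EFin \o _ = ((EFin \o f) \- (EFin \o cst c))%E)//.
by apply: integrableB => //; [exact: loc_integrable_oo|exact: integrable_cst_oo].
Qed.

Lemma Rintegral_sub_cst f (x y c : R) : loc_integrable_pos f -> 0 <= x -> x <= y ->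
  \int[mu]_(t in `]x, y[) (f t - c) = prim f y - prim f x - c * (y - x).
Proof.
move=> fi x0 xy; rewrite RintegralB//; last 2 first.
- exact: loc_integrable_oo.
- exact: integrable_cst_oo.
by rewrite Rintegral_prim// Rintegral_cst_oo.
Qed.

(** The positive and negative parts of [f - c], [c] the mean over [(0, v)], have
    equal integrals, and the positive part is at least the integral of [f - c]
    over [(0, u)]. *)
Lemma mean_osc_ge f (u v : R) : loc_integrable_pos f -> 0 < u -> u <= v ->
  2 * (u / v) * (hardy f u - hardy f v) <= mean_osc f `]0, v[.
Proof.
move=> fi u0 uv; have v0 : 0 < v by exact: lt_le_trans uv.
rewrite mean_osc_oo ?(ltW v0)// average_oo ?(ltW v0)// subr0.
rewrite -/(prim f v) -/(hardy f v); set c := hardy f v.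
have di w z : 0 <= w -> mu.-integrable `]w, z[ (EFin \o (fun t => `|f t - c|)).
  move=> w0; apply: integrable_dist => //; last exact: integrable_cst_oo.
  exact: loc_integrable_oo.
rewrite (Rintegral_oo_split (ltW u0) uv); last exact: di.
have H1 : prim f u - prim f 0 - c * (u - 0) <= \int[mu]_(t in `]0, u[) `|f t - c|.
  rewrite -Rintegral_sub_cst ?(ltW u0)//; apply: le_Rintegral => //.
  - exact: integrable_sub_cst_oo.
  - exact: di.
  - by move=> t _; exact: ler_norm.
have H2 : - (prim f v - prim f u - c * (v - u)) <= \int[mu]_(t in `]u, v[) `|f t - c|.
  rewrite -Rintegral_sub_cst ?(ltW u0)// -mulN1r -RintegralZl//; last first.
    exact/integrable_sub_cst_oo/ltW.
  apply: le_Rintegral => //.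
  - rewrite (_ : EFin \o _ = (fun t => (-1)%:E * (f t - c)%:E)%E)//.
    exact/integrableZl/integrable_sub_cst_oo/ltW.
  - exact/di/ltW.
  - by move=> t _; rewrite mulN1r -normrN; exact: ler_norm.
rewrite ler_pdivlMl//; move: H1 H2; rewrite prim0 !primE// -/c.
have -> : v * (2 * (u / v) * (hardy f u - c)) = 2 * u * (hardy f u - c).
  by field; rewrite gt_eqF.
lra.
Qed.

(** * Oscillations of nonincreasing functions *)

Definition nonincreasing_pos f := forall x y : R, 0 < x -> x <= y -> f y <= f x.

(** Both difference quotients are compared with the value [f y]. *)
Lemma prim_concave f (x y z : R) : nonincreasing_pos f -> loc_integrable_pos f ->
  0 <= x -> x <= y -> y <= z ->
  (y - x) * (prim f z - prim f y) <= (z - y) * (prim f y - prim f x).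
Proof.
move=> fd fi x0 xy yz; have y0 := le_trans x0 xy.
move: y0; rewrite le_eqVlt => /predU1P[y0|y0].
  have -> : x = y by lra.
  by rewrite !subrr mul0r mulr0.
have H1 : f y * (y - x) <= prim f y - prim f x.
  apply: ge_prim_sub => // t xt ty; apply: fd; last exact: ltW.
  exact: le_lt_trans xt.
have H2 : prim f z - prim f y <= f y * (z - y).
  by apply: le_prim_sub => //; [exact: ltW|move=> t yt _; apply: fd (ltW yt)].
have yx : 0 <= y - x by lra.
have zy : 0 <= z - y by lra.
have := ler_wpM2l yx H2; have := ler_wpM2l zy H1; lra.
Qed.

Lemma hardy_nonincreasing f : nonincreasing_pos f -> loc_integrable_pos f ->
  nonincreasing_pos (hardy f).
Proof.
move=> fd fi x y x0 xy; have y0 : 0 < y := lt_le_trans x0 xy.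
have := prim_concave fd fi (lexx 0) (ltW x0) xy; rewrite prim0 !primE// => H.
by rewrite -(ler_pM2l (mulr_gt0 x0 y0)); lra.
Qed.

(** For a nonincreasing function the oscillation integral is governed by the
    point [c] at which the function crosses its mean. *)
Lemma mean_osc_crossing f (a b : R) : nonincreasing_pos f ->
  loc_integrable_pos f -> 0 <= a -> a < b ->
  let l := (prim f b - prim f a) / (b - a) in
  exists c, [/\ a <= c, c <= b &
    mean_osc f `]a, b[ = 2 * (prim f c - prim f a - l * (c - a)) / (b - a)].
Proof.
move=> fd fi a0 ab l; have ba0 : 0 < b - a by rewrite subr_gt0.
(* a is included so that the set is nonempty *)
pose S := [set x | x = a \/ [/\ a < x, x < b & l < f x]].
have Sa : S a by left.
have Sb : ubound S b by move=> x [->|[_ /ltW//]]; exact: ltW.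
have supS : has_sup S by split; [exists a|exists b].
pose c := sup S; have ac : a <= c by apply: ub_le_sup => //; exists b.
have cb : c <= b by apply: ge_sup => //; exists a.
have c0 : 0 <= c by exact: le_trans ac.
have gtl t : a < t -> t < c -> l <= f t.
  move=> at_ tc; have [y [ya|[ay yb ly]] ty] := sup_gt (ex_intro _ a Sa) tc.
    by move: ty; rewrite ya ltNge (ltW at_).
  by apply: le_trans (ltW ly) _; apply: fd; [exact: le_lt_trans at_|exact: ltW].
have lel t : c < t -> t < b -> f t <= l.
  move=> ct tb; rewrite leNgt; apply/negP => lft.
  have : t <= c.
    by apply: ub_le_sup; [exists b|right; split => //; exact: le_lt_trans ct].
  by rewrite leNgt ct.
exists c; split => //; rewrite mean_osc_oo ?(ltW ab)// average_oo ?(ltW ab)//.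
rewrite (Rintegral_prim fi) ?(ltW ab)// [_^-1 * (_ - _)]mulrC -/l mulrC; congr (_ / _).
have di : mu.-integrable `]a, b[ (EFin \o (fun t => `|f t - l|)).
  apply: integrable_dist => //; last exact: integrable_cst_oo.
  exact: loc_integrable_oo.
rewrite (Rintegral_oo_split ac cb di).
have -> : \int[mu]_(t in `]a, c[) `|f t - l| = \int[mu]_(t in `]a, c[) (f t - l).
  apply: eq_Rintegral => t /set_mem /=; rewrite in_itv /= => /andP[at_ tc].
  by rewrite ger0_norm// subr_ge0 gtl.
have -> : \int[mu]_(t in `]c, b[) `|f t - l| =
    \int[mu]_(t in `]c, b[) (-1 * (f t - l)).
  apply: eq_Rintegral => t /set_mem /=; rewrite in_itv /= => /andP[ct tb].
  by rewrite mulN1r ler0_norm// subr_le0 lel.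
rewrite RintegralZl//; last exact: integrable_sub_cst_oo.
rewrite !Rintegral_sub_cst//.
have : l * (b - a) = prim f b - prim f a by rewrite /l divfK ?gt_eqF.
lra.
Qed.

(** Intervals [(0, t)] carry the largest oscillations. With [l] the mean over
    [(a, b)], the function [L x = prim f x - l * x] is concave, nonnegative at [a],
    with [L a = L b] and maximum at [c]. If [L c > L a], the line through
    [(c, L c)] and [(b, L b)] reaches 0 at some [t >= b], where [L t <= 0]: the mean
    over [(0, t)] is at most [l], and comparing slopes shows that [(0, t)] has at
    least the oscillation of [(a, b)]. *)
Lemma mean_osc_le f (B : R) : nonincreasing_pos f -> loc_integrable_pos f ->
  (forall s t, 0 < s -> s < t -> (s / t) * (hardy f s - hardy f t) <= B) ->
  forall I, bounded_interval_pos I -> mean_osc f I <= 2 * B.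
Proof.
move=> fd fi HB I /(mean_osc_endpoints fi)[a [b [a0 ab ->]]].
have B0 : 0 <= B.
  apply: le_trans (HB 1 2 _ _); rewrite ?ltr01 ?ltr1n// mulr_ge0 ?divr_ge0//.
  by rewrite subr_ge0; apply: hardy_nonincreasing => //; rewrite ler1n.
have [c [ac cb ->]] := mean_osc_crossing fd fi a0 ab.
have ba0 : 0 < b - a by rewrite subr_gt0.
pose l := (prim f b - prim f a) / (b - a); rewrite -/l.
have lE : l * (b - a) = prim f b - prim f a by rewrite /l divfK ?gt_eqF.
pose L x := prim f x - l * x.
have Lab : L a = L b by rewrite /L; lra.
have -> : prim f c - prim f a - l * (c - a) = L c - L a by rewrite /L; ring.
rewrite -mulrA ler_pM2l// ler_pdivrMr//.
have [A0|A0] := leP (L c - L a) 0.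
  by apply: le_trans A0 _; rewrite mulr_ge0// ltW.
have c0 : 0 < c.
  rewrite lt_neqAle (le_trans a0 ac) andbT; apply: contraTneq A0 => c0.
  have -> : a = c by lra.
  by rewrite subrr ltxx.
have cb' : c < b.
  by rewrite lt_neqAle cb andbT; apply: contraTneq A0 => ->; rewrite Lab subrr ltxx.
have Lac : a * L c <= c * L a.
  by have := prim_concave fd fi (lexx 0) a0 ac; rewrite prim0 /L; lra.
have Lc0 : L c - L a <= L c.
  have ca : a < c.
    by rewrite lt_neqAle ac andbT; apply: contraTneq A0 => ->; rewrite subrr ltxx.
  have : 0 <= (c - a) * L a.
    by have := mulr_ge0 a0 (ltW A0); lra.
  by rewrite pmulr_rge0 ?subr_gt0//; lra.
(* the line through (c, L c) and (b, L b) vanishes at t *)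
pose t := c + L c * (b - c) / (L c - L a).
have tE : (t - c) * (L c - L a) = L c * (b - c).
  by rewrite /t addrAC subrr add0r divfK ?gt_eqF.
have bt : b <= t.
  have : (b - c) * (L c - L a) <= (t - c) * (L c - L a).
    by rewrite tE mulrC ler_wpM2r// subr_ge0.
  by rewrite ler_pM2r// lerD2r.
have t0 : 0 < t := lt_trans c0 (lt_le_trans cb' bt).
have Lt : L t <= 0.
  have bc0 : 0 < b - c by rewrite subr_gt0.
  rewrite -(pmulr_rle0 _ bc0).
  have := prim_concave fd fi (ltW c0) cb bt.
  have -> : prim f t = L t + l * t by rewrite /L; ring.
  have -> : prim f b = L b + l * b by rewrite /L; ring.
  have -> : prim f c = L c + l * c by rewrite /L; ring.
  rewrite -Lab; move: tE; lra.
have Bt : L c <= B * t.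
  apply: le_trans (ler_wpM2r (ltW t0) (HB c t c0 (lt_le_trans cb' bt))).
  have -> : c / t * (hardy f c - hardy f t) * t = prim f c - c * hardy f t.
    by rewrite primE//; field; rewrite gt_eqF.
  rewrite /L lerD2l lerN2 mulrC ler_wpM2r ?(ltW c0)//.
  by rewrite -(ler_pM2l t0) -primE// mulrC -subr_le0.
have tA : t * (L c - L a) <= L c * (b - a).
  by move: tE Lac; lra.
rewrite -(ler_pM2l t0); apply: le_trans tA _.
by rewrite mulrA [t * B]mulrC ler_wpM2r// ltW.
Qed.

Lemma bmo_loc f : loc_integrable_pos f ->
  bmo f = ereal_sup [set (mean_osc f I)%:E | I in @bounded_interval_pos R].
Proof. by move=> fi; rewrite /bmo; case: asboolP. Qed.

Lemma bmo_ge f (u v : R) : loc_integrable_pos f -> 0 < u -> u <= v ->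
  ((2 * (u / v * (hardy f u - hardy f v)))%:E <= bmo f)%E.
Proof.
move=> fi u0 uv; rewrite bmo_loc//.
apply: (@le_trans _ _ (mean_osc f `]0, v[)%:E).
  by rewrite lee_fin mulrA mean_osc_ge.
apply: ereal_sup_ubound; exists `]0, v[%classic => //.
by apply: bounded_interval_pos_oo => //; exact: lt_le_trans uv.
Qed.

Lemma bmo_le f (B : R) : nonincreasing_pos f -> loc_integrable_pos f ->
  (forall s t, 0 < s -> s < t -> s / t * (hardy f s - hardy f t) <= B) ->
  (bmo f <= (2 * B)%:E)%E.
Proof.
move=> fd fi HB; rewrite bmo_loc//; apply: ge_ereal_sup => _ [I HI <-].
by rewrite lee_fin; exact: mean_osc_le.
Qed.

(** * The transcendental equation *)

Lemma ln_tangent (u v : R) : 0 < u -> 0 < v -> ln v - ln u <= (v - u) / u.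
Proof.
move=> u0 v0; rewrite -ln_div ?posrE//.
have -> : v / u = 1 + (v - u) / u by field; rewrite gt_eqF.
apply: le_ln1Dx; have : 0 < v / u by rewrite divr_gt0.
by have -> : v / u = 1 + (v - u) / u by [field; rewrite gt_eqF]; lra.
Qed.

(** [crit b = 0] is the equation of [gamma1] in the variable [b = ln gamma1];
    it is also the critical point equation of the function
    [y |-> (y - ln (1 + y)) * expR (- y)]. *)
Definition crit (b : R) : R := b - ln (1 + b) - b / (1 + b).

(** [crit] is strictly convex and vanishes at 0, so its difference quotient
    [crit b / b] is strictly increasing. This yields the sign of [crit] on both
    sides of a positive root, and the uniqueness of that root. *)
Lemma crit_slope (y z : R) : 0 < y -> y < z -> z * crit y < y * crit z.
Proof.
move=> y0 yz; have z0 : 0 < z by exact: lt_trans yz.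
have y1 : 0 < 1 + y by lra.
have z1 : 0 < 1 + z by lra.
have H1 := ln_tangent y1 z1; have := ln_tangent y1 ltr01; rewrite ln1 => H2.
have Hln : y * ln (1 + z) <= z * ln (1 + y).
  have K1 := ler_wpM2l (ltW y0) H1.
  have zy : 0 <= z - y by lra.
  have K2 := ler_wpM2l zy H2.
  have E : y * ((1 + z - (1 + y)) / (1 + y)) = - ((z - y) * ((1 - (1 + y)) / (1 + y))).
    by field; rewrite gt_eqF.
  by move: K1 K2; rewrite E; lra.
have Hinv : y * z / (1 + z) < y * z / (1 + y).
  by rewrite ltr_pM2l ?mulr_gt0// ltf_pV2 ?posrE//; lra.
by rewrite /crit; move: Hinv; lra.
Qed.

Lemma crit_lt0 (b y : R) : crit b = 0 -> 0 < y -> y < b -> crit y < 0.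
Proof.
move=> b0 y0 yb; have := crit_slope y0 yb; rewrite b0 mulr0.
by rewrite pmulr_rlt0// (lt_trans y0).
Qed.

Lemma crit_gt0 (b y : R) : crit b = 0 -> 0 < b -> b < y -> 0 < crit y.
Proof.
by move=> b0 bp yb; have := crit_slope bp yb; rewrite b0 mulr0 pmulr_rgt0.
Qed.

Lemma crit_uniq (b c : R) : 0 < b -> 0 < c -> crit b = 0 -> crit c = 0 -> b = c.
Proof.
move=> b0 c0 hb hc; have [bc|cb|//] := ltgtP b c.
  by have := crit_lt0 hc b0 bc; rewrite hb ltxx.
by have := crit_lt0 hb c0 cb; rewrite hc ltxx.
Qed.

Lemma is_derive_profile (y : R) : 0 < 1 + y ->
  is_derive y (1 : R) (fun y : R => (y - ln (1 + y)) * expR (- y))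
    (- crit y * expR (- y)).
Proof.
move=> y1.
have d0 : is_derive y (1 : R) (fun y : R => 1 + y) (0 + 1).
  by apply: is_deriveD.
have d1 : is_derive y (1 : R) (fun y : R => ln (1 + y)) (1 + y)^-1.
  by have := is_derive1_comp (is_derive1_ln y1) d0; rewrite add0r mulr1.
have d2 : is_derive y (1 : R) (fun y : R => expR (- y)) (- expR (- y)).
  have := is_derive1_comp (is_derive_expR (- y)) (is_deriveNid y (1 : R)).
  by rewrite mulrN1.
apply: is_derive_eq.
rewrite /crit /GRing.scale /=; field; rewrite gt_eqF//.
Qed.

(** The derivative [- crit y * expR (- y)] changes sign only at the root. *)
Lemma profile_le (b y : R) : 0 < b -> crit b = 0 -> 0 <= y ->
  (y - ln (1 + y)) * expR (- y) <= b / (1 + b) * expR (- b).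
Proof.
move=> b0 hb y0.
have -> : b / (1 + b) = b - ln (1 + b) by move: hb; rewrite /crit; lra.
pose f := fun y : R => (y - ln (1 + y)) * expR (- y); rewrite -/(f y) -/(f b).
have df (z : R) : 0 <= z -> is_derive z (1 : R) f (- crit z * expR (- z)).
  by move=> z0; apply: is_derive_profile; lra.
have cf (x z : R) : 0 <= x -> {within `[x, z], continuous f}.
  move=> x0; apply: derivable_within_continuous => t; rewrite in_itv /= => /andP[xt _].
  by have [] := df t (le_trans x0 xt).
have f' (z : R) : 0 <= z -> derive1 f z = - crit z * expR (- z).
  by move=> z0; rewrite derive1E; have := df z z0; exact: @derive_val.
have [yb|by_] := leP y b.
- apply: (@ger0_derive1_le_cc _ f 0 b) => //.
  + by move=> z; rewrite in_itv /= => /andP[z0 _]; have [] := df z (ltW z0).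
  + move=> z; rewrite in_itv /= => /andP[z0 zb]; rewrite f' ?(ltW z0)//.
    by rewrite mulr_ge0 ?expR_ge0// oppr_ge0 ltW// (crit_lt0 hb).
  + exact: cf.
  + by rewrite in_itv /= y0.
  + by rewrite in_itv /= lexx ltW.
- apply: (@ler0_derive1_le_cc _ f b y) => //.
  + move=> z; rewrite in_itv /= => /andP[z0 _].
    by have [] := df z (ltW (lt_trans b0 z0)).
  + move=> z; rewrite in_itv /= => /andP[z0 zb]; rewrite f' ?(ltW (lt_trans b0 z0))//.
    by rewrite mulr_le0_ge0 ?expR_ge0// oppr_le0 ltW// (crit_gt0 hb).
  + exact/cf/ltW.
  + by rewrite in_itv /= lexx ltW.
  + by rewrite in_itv /= lexx ltW.
  + exact: ltW.
Qed.

(** * Numerical bounds *)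

Implicit Types x c : R.

Definition exp_sum n x : R := \sum_(0 <= k < n) x ^+ k / k`!%:R.

Lemma exp_sum_le n x : 0 <= x -> exp_sum n x <= expR x.
Proof.
move=> x0; apply: (nondecreasing_cvgn_le _ (is_cvg_series_exp_coeff x)).
apply/nondecreasing_seqP => k; rewrite seriesSr lerDl.
exact: exp_coeff_ge0.
Qed.

(** [n`! * j`! <= (n + j)`!] bounds the tail of the exponential series by
    [x ^+ n / n`!] times the whole series. *)
Lemma exp_sum_tail n x : 0 <= x ->
  expR x <= exp_sum n x + x ^+ n / n`!%:R * expR x.
Proof.
move=> x0; apply: limr_le; first exact: is_cvg_series_exp_coeff.
near=> m; have nm : (n <= m)%N by near: m; exact: nbhs_infty_ge.
rewrite /series /= (@big_cat_nat _ _ _ n)//= lerD2l.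
have /= H : x ^+ n / n`!%:R * exp_sum (m - n) x <= x ^+ n / n`!%:R * expR x.
  by rewrite ler_wpM2l ?exp_sum_le// divr_ge0// exprn_ge0.
apply: le_trans H; rewrite /exp_sum mulr_sumr -{1}[n]add0n big_addn.
apply: ler_sum => j _; rewrite /exp_coeff /= addnC exprD mulf_div.
rewrite ler_wpM2l ?mulr_ge0 ?exprn_ge0// lef_pV2 ?posrE ?mulr_gt0 ?ltr0n ?fact_gt0//.
rewrite -natrM ler_nat -(@bin_fact (n + j) n) ?leq_addr//.
by rewrite addKn leq_pmull// bin_gt0 leq_addr.
Unshelve. all: by end_near. Qed.

(** The Taylor expansion of the exponential in nested form, [c] replacing the
    innermost factor. The factor that makes [exp_nested c n 1 x] equal to [expR x]
    lies between 1 and [expR x], whence the bounds below. *)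
Fixpoint exp_nested c (n k : nat) x : R :=
  if n is n'.+1 then 1 + x / k%:R * exp_nested c n' k.+1 x else c.

Lemma exp_nestedE c n k x :
  exp_nested c n k.+1 x =
  k`!%:R * (\sum_(0 <= j < n) x ^+ j / (k + j)`!%:R) + c * (x ^+ n * k`!%:R / (k + n)`!%:R).
Proof.
have fne i : i`!%:R != 0 :> R by rewrite pnatr_eq0 -lt0n fact_gt0.
elim: n k => [|n IH] k /=.
  by rewrite big_geq// mulr0 add0r expr0 mul1r addn0 divff ?mulr1.
rewrite {}IH big_nat_recl//= addn0 expr0 factS natrM.
under [in RHS]eq_bigr => j _ do rewrite exprS -mulrA addnS -addSn.
rewrite -mulr_sumr exprS addnS -addSn; set s := \sum_(_ <= _ < _) _.
have k1 : k.+1%:R != 0 :> R by rewrite pnatr_eq0.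
by field; rewrite !fne nat1r pnatr_eq0.
Qed.

Lemma exp_nested0E c n x :
  exp_nested c n 1 x = exp_sum n x + c * (x ^+ n / n`!%:R).
Proof. by rewrite exp_nestedE fact0 mul1r mulr1. Qed.

Lemma exp_ge_nested n x : 0 <= x -> exp_nested 1 n 1 x <= expR x.
Proof.
move=> x0; apply: le_trans (exp_sum_le n.+1 x0).
by rewrite exp_nested0E mul1r /exp_sum big_nat_recr.
Qed.

Lemma exp_le_nested c n x : 0 <= x -> expR x <= c -> expR x <= exp_nested c n 1 x.
Proof.
move=> x0 xc; apply: le_trans (exp_sum_tail n x0) _.
by rewrite exp_nested0E lerD2l mulrC ler_wpM2r// divr_ge0// exprn_ge0.
Qed.

Lemma exp_le3 x : x <= 1 -> expR x <= 3.
Proof.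
move=> x1; have x1' : expR x <= expR 1 by rewrite ler_expR.
have := exp_sum_tail 3 (@ler01 R); rewrite /exp_sum !big_nat_recr //= big_geq//.
rewrite !expr1n fact0 !factS fact0 !mul1r /= => H.
lra.
Qed.

(** An enclosure of the root of [crit], namely 1.536591354 and 1.536591357. The
    decimals are split into short groups because numerals are unary. *)
Definition b_lo : R := 1 + 5365 / 10 ^+ 4 + 9135 / 10 ^+ 8 + 4 / 10 ^+ 9.
Definition b_hi : R := 1 + 5365 / 10 ^+ 4 + 9135 / 10 ^+ 8 + 7 / 10 ^+ 9.

Lemma critE (b : R) : 0 < b -> crit b = b ^+ 2 / (1 + b) - ln (1 + b).
Proof. by move=> b0; rewrite /crit; field; rewrite gt_eqF; lra. Qed.

Lemma crit_lo : crit b_lo < 0.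
Proof.
have b0 : 0 < b_lo by rewrite /b_lo; lra.
rewrite critE// subr_lt0 -ltr_expR lnK ?posrE; last by lra.
(* b_lo ^+ 2 / (1 + b_lo), rounded up *)
pose X : R := 9308 / 10 ^+ 4 + 2119 / 10 ^+ 8 + 2568 / 10 ^+ 12.
have xX : b_lo ^+ 2 / (1 + b_lo) <= X.
  by rewrite ler_pdivrMr; rewrite /b_lo /X; clear; lra.
have X0 : 0 <= X by rewrite /X; clear; lra.
have X1 : X <= 1 by rewrite /X; clear; lra.
apply: (@le_lt_trans _ _ (expR X)); first by rewrite ler_expR.
apply: le_lt_trans (exp_le_nested 14 X0 (exp_le3 X1)) _.
by rewrite /exp_nested /b_lo /X; clear; lra.
Qed.

Lemma crit_hi : 0 < crit b_hi.
Proof.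
have b0 : 0 < b_hi by rewrite /b_hi; lra.
rewrite critE// subr_gt0 -ltr_expR lnK ?posrE; last by lra.
(* b_hi ^+ 2 / (1 + b_hi), rounded down *)
pose X : R := 9308 / 10 ^+ 4 + 2119 / 10 ^+ 8 + 5101 / 10 ^+ 12.
have xX : X <= b_hi ^+ 2 / (1 + b_hi).
  by rewrite ler_pdivlMr; rewrite /b_hi /X; clear; lra.
have X0 : 0 <= X by rewrite /X; clear; lra.
apply: (@lt_le_trans _ _ (expR X)); last by rewrite ler_expR.
apply: lt_le_trans (exp_ge_nested 14 X0).
by rewrite /exp_nested /b_hi /X; clear; lra.
Qed.

Lemma crit_root_bounds (b : R) : 0 < b -> crit b = 0 -> b_lo <= b <= b_hi.
Proof.
move=> b0 hb; rewrite !leNgt; apply/andP; split; apply/negP => h.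
  by have := lt_trans crit_lo (crit_gt0 hb b0 h); rewrite ltxx.
have bh0 : 0 < b_hi by rewrite /b_hi; lra.
by have := lt_trans (crit_lt0 hb bh0 h) crit_hi; rewrite ltxx.
Qed.

Lemma crit_root_exists : exists b : R, 0 < b /\ crit b = 0.
Proof.
have lh : b_lo <= b_hi by rewrite /b_lo /b_hi; lra.
have [||b] := @IVT R crit b_lo b_hi 0 lh.
- apply: continuous_in_subspaceT => t /set_mem /=.
  rewrite in_itv /= => /andP[bt _]; have t0 : 0 < 1 + t by move: bt; rewrite /b_lo; lra.
  apply: cvgB; last first.
    apply: cvgM; first exact: cvg_id.
    by apply: cvgV; [rewrite gt_eqF|apply: cvgD; [exact: cvg_cst|exact: cvg_id]].
  apply: cvgB; first exact: cvg_id.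
  apply: continuous_comp; last exact: continuous_ln.
  by apply: cvgD; [exact: cvg_cst|exact: cvg_id].
- by rewrite ge_min le_max (ltW crit_lo) (ltW crit_hi) orbT.
- rewrite in_itv /= => /andP[bb _] b0; exists b; split => //.
  by move: bb; rewrite /b_lo; lra.
Qed.

(** The optimal constant [alpha0], for [b] the root of [crit]. *)
Definition crit_value (b : R) : R := 4 * (b / (1 + b) * expR (- b)).

Lemma exp_root (b : R) : 0 < b -> crit b = 0 ->
  expR b = (1 + b) * expR (b / (1 + b)).
Proof.
move=> b0 hb; have -> : expR b = expR (ln (1 + b) + b / (1 + b)).
  by congr expR; move: hb; rewrite /crit; lra.
by rewrite expRD lnK// posrE; lra.
Qed.

(** The decimals enclose [b / (1 + b)] for [b] between [b_lo] and [b_hi], and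
    its exponential, closely enough for eight digits of the constant. *)
Lemma exp_ratio_bounds x :
  6057 / 10 ^+ 4 + 7016 / 10 ^+ 8 + 1432 / 10 ^+ 12 <= x ->
  x <= 6057 / 10 ^+ 4 + 7016 / 10 ^+ 8 + 1899 / 10 ^+ 12 ->
  18326 / 10 ^+ 4 + 6311 / 10 ^+ 8 + 19 / 10 ^+ 10 <= expR x /\
  expR x <= 18326 / 10 ^+ 4 + 6311 / 10 ^+ 8 + 29 / 10 ^+ 10.
Proof.
rewrite -(ler_expR _ x) -(ler_expR x) => xl xh; split.
  apply: le_trans xl; apply: le_trans (exp_ge_nested 12 _); last by clear; lra.
  by clear; rewrite /exp_nested; lra.
apply: (le_trans xh); apply: le_trans (exp_le_nested 12 _ (exp_le3 _)) _.
- by clear; lra.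
- by clear; lra.
- by clear; rewrite /exp_nested; lra.
Qed.

(** The quotient is increasing in [b] and decreasing in the two factors of the
    denominator, so rational enclosures propagate. *)
Lemma quotient_bounds (lo hi el eh b e c d : R) : 0 < lo -> lo <= b -> b <= hi ->
  0 < el -> el <= e -> e <= eh -> 0 <= c -> 0 <= d ->
  c * ((1 + hi) ^+ 2 * eh) < 4 * lo -> 4 * hi < d * ((1 + lo) ^+ 2 * el) ->
  c < 4 * b / ((1 + b) ^+ 2 * e) < d.
Proof.
move=> lo0 lb bh el0 ele eeh c0 d0 Hc Hd.
have b1 : 0 < 1 + b by lra.
have e0 : 0 < e by exact: lt_le_trans ele.
have D0 : 0 < (1 + b) ^+ 2 * e by rewrite mulr_gt0 ?exprn_gt0.
have Dl : (1 + lo) ^+ 2 * el <= (1 + b) ^+ 2 * e.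
  by rewrite ler_pM ?exprn_ge0 ?lerXn2r ?nnegrE ?(ltW el0) ?(ltW b1) ?lerD2l//; lra.
have Dh : (1 + b) ^+ 2 * e <= (1 + hi) ^+ 2 * eh.
  by rewrite ler_pM ?exprn_ge0 ?lerXn2r ?nnegrE ?(ltW e0) ?(ltW b1) ?lerD2l//; lra.
rewrite ltr_pdivlMr// ltr_pdivrMr//; apply/andP; split.
  apply: le_lt_trans (ler_wpM2l c0 Dh) _; apply: lt_le_trans Hc _; lra.
by apply: lt_le_trans (ler_wpM2l d0 Dl); apply: le_lt_trans Hd; lra.
Qed.

Lemma crit_value_approx (b : R) : 0 < b -> crit b = 0 ->
  `|crit_value b - (5212 / 10 ^+ 4 + 3637 / 10 ^+ 8)| < 2 / 10 ^+ 8.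
Proof.
move=> b0 hb; have /andP[bl bh] := crit_root_bounds b0 hb.
have -> : crit_value b = 4 * b / ((1 + b) ^+ 2 * expR (b / (1 + b))).
  rewrite /crit_value expRN exp_root//; field.
  by rewrite !gt_eqF ?expR_gt0//; lra.
have [El Eh] : 18326 / 10 ^+ 4 + 6311 / 10 ^+ 8 + 19 / 10 ^+ 10 <= expR (b / (1 + b))
    /\ expR (b / (1 + b)) <= 18326 / 10 ^+ 4 + 6311 / 10 ^+ 8 + 29 / 10 ^+ 10.
  have b1 : 0 < 1 + b by lra.
  apply: exp_ratio_bounds; rewrite ?ler_pdivlMr ?ler_pdivrMr//; clear b1 hb.
    by move: bl; rewrite /b_lo; clear; lra.
  by move: bh; rewrite /b_hi; clear; lra.
rewrite ltr_distl; apply: (quotient_bounds _ bl bh _ El Eh); clear;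
  rewrite /b_lo /b_hi; lra.
Qed.

Lemma crit_value_gt0 (b : R) : 0 < b -> 0 < crit_value b.
Proof.
by move=> b0; rewrite /crit_value !mulr_gt0 ?expR_gt0// invr_gt0; lra.
Qed.

(** For [u = expR (b / (1 + b)) * m] and [v = expR b * m] the first two bounds say
    that [u < 2 m <= v]; the third one is the sign of the term left over in
    [log_part]. *)
Lemma crit_root_exp (b : R) : 0 < b -> crit b = 0 ->
  [/\ expR (b / (1 + b)) < 2, 2 <= expR b & 2 * b + 2 <= expR b + ln 2].
Proof.
move=> b0 hb; have /andP[bl bh] := crit_root_bounds b0 hb.
have b1 : 0 < 1 + b by lra.
have al : 60 / 10 ^+ 2 <= b / (1 + b).
  by rewrite ler_pdivlMr//; move: bl; rewrite /b_lo; lra.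
have ah : b / (1 + b) <= 61 / 10 ^+ 2.
  by rewrite ler_pdivrMr//; move: bh; rewrite /b_hi; lra.
have exp_hi (x : R) : 0 <= x -> x <= 61 / 10 ^+ 2 -> expR x < 2.
  move=> x0 xh; apply: (@le_lt_trans _ _ (expR (61 / 10 ^+ 2))); first by rewrite ler_expR.
  apply: le_lt_trans (exp_le_nested 4 _ (exp_le3 _)) _; [lra|lra|].
  by rewrite /exp_nested; lra.
have E1 : expR (b / (1 + b)) < 2 by apply: exp_hi => //; lra.
have E2 : 181 / 10 ^+ 2 <= expR (b / (1 + b)).
  apply: (@le_trans _ _ (expR (60 / 10 ^+ 2))); last by rewrite ler_expR.
  by apply: le_trans (exp_ge_nested 3 _); [rewrite /exp_nested; lra|lra].
have ln2 : 61 / 10 ^+ 2 <= ln 2 :> R.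
  by rewrite -ler_expR lnK ?posrE//; apply/ltW/exp_hi; lra.
have := exp_root b0 hb; move: bl bh; rewrite /b_lo /b_hi => bl bh bE.
have : (1 + b) * (181 / 10 ^+ 2) <= (1 + b) * expR (b / (1 + b)) by rewrite ler_wpM2l// ltW.
by rewrite -bE => E3; clear -E1 E3 ln2 bl bh; split => //; lra.
Qed.

(** * The lower bound for the Hardy operator *)

Lemma cont_affine_inv (p q x y : R) : 0 < x ->
  {within `[x, y], continuous (fun t : R => p + q / t)}.
Proof.
move=> x0; apply: continuous_in_subspaceT => t /set_mem /=.
rewrite in_itv /= => /andP[xt _]; have t0 : t != 0 by rewrite gt_eqF// (lt_le_trans x0).
by apply: cvgD; [exact: cvg_cst|apply: cvgMr; exact: cvgV].
Qed.

Lemma integrable_affine_inv (p q x y : R) : 0 < x ->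
  mu.-integrable `]x, y[ (EFin \o (fun t : R => p + q / t)).
Proof.
move=> x0; apply: (@integrableS _ _ _ mu `[x, y]) => //.
  exact: subset_itv_oo_cc.
apply: continuous_compact_integrable; first exact: segment_compact.
exact: cont_affine_inv.
Qed.

Lemma Rintegral_affine_inv (p q x y : R) : 0 < x -> x <= y ->
  \int[mu]_(t in `]x, y[) (p + q / t) = p * (y - x) + q * (ln y - ln x).
Proof.
move=> x0; rewrite le_eqVlt => /predU1P[->|xy].
  by rewrite set_itvoo0 Rintegral_set0; ring.
have iE : mu.-integrable `[x, y] (EFin \o (fun t : R => p + q / t)).
  apply: continuous_compact_integrable; first exact: segment_compact.
  exact: cont_affine_inv.
have iE1 : mu.-integrable `[x, y[ (EFin \o (fun t : R => p + q / t)).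
  by apply: integrableS iE => //; apply: subset_itvl; rewrite bnd_simp.
rewrite Rintegral_itv_obnd_cbnd ?Rintegral_itv_bndo_bndc//; last first.
  exact: integrable_affine_inv.
have dF (t : R) : 0 < t -> is_derive t (1 : R) (fun t : R => p * t + q * ln t) (p + q / t).
  move=> t0; have d1 := is_derive1_ln t0.
  by apply: is_derive_eq; rewrite /GRing.scale /= mulr1.
have cF (t : R) : 0 < t -> {for t, continuous (fun t : R => p * t + q * ln t)}.
  move=> t0; apply: differentiable_continuous; apply/derivable1_diffP.
  by have [] := dF t t0.
have y0 : 0 < y by exact: lt_trans xy.
rewrite /Rintegral (@continuous_FTC2 _ _ (fun t : R => p * t + q * ln t)) //=; first ring.
- exact: cont_affine_inv.
- split.
  + move=> t; rewrite in_itv /= => /andP[xt _].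
    by have [] := dF t (lt_trans x0 xt).
  + exact/cvg_at_right_filter/cF.
  + exact/cvg_at_left_filter/cF.
- move=> t; rewrite in_itv /= => /andP[xt _].
  rewrite derive1E; have := dF t (lt_trans x0 xt); exact: @derive_val.
Qed.

Lemma prim_hardy_ge f (x y p q : R) : loc_integrable_pos (hardy f) ->
  0 < x -> x <= y -> (forall t, x < t -> t < y -> p * t + q <= prim f t) ->
  p * (y - x) + q * (ln y - ln x) <= prim (hardy f) y - prim (hardy f) x.
Proof.
move=> gi x0 xy H; rewrite -Rintegral_affine_inv// -Rintegral_prim// ?(ltW x0)//.
apply: le_Rintegral => //.
- exact: integrable_affine_inv.
- exact/loc_integrable_oo/ltW.
move=> t /=; rewrite in_itv /= => /andP[xt ty]; have t0 : 0 < t := lt_trans x0 xt.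
rewrite -(ler_pM2l t0) -primE// mulrDr [t * (q / t)]mulrC divfK ?gt_eqF//.
by rewrite mulrC; exact: H.
Qed.

Lemma prim_hardy_le f (x y p q : R) : loc_integrable_pos (hardy f) ->
  0 < x -> x <= y -> (forall t, x < t -> t < y -> prim f t <= p * t + q) ->
  prim (hardy f) y - prim (hardy f) x <= p * (y - x) + q * (ln y - ln x).
Proof.
move=> gi x0 xy H; rewrite -Rintegral_affine_inv// -Rintegral_prim// ?(ltW x0)//.
apply: le_Rintegral => //.
- exact/loc_integrable_oo/ltW.
- exact: integrable_affine_inv.
move=> t /=; rewrite in_itv /= => /andP[xt ty]; have t0 : 0 < t := lt_trans x0 xt.
rewrite -(ler_pM2l t0) -primE// mulrDr [t * (q / t)]mulrC divfK ?gt_eqF//.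
by rewrite mulrC; exact: H.
Qed.

Lemma chord_le f (p x y t : R) : nonincreasing_pos f -> loc_integrable_pos f ->
  0 <= x -> x < y -> p * (y - x) = prim f y - prim f x -> x <= t -> t <= y ->
  p * t + (prim f x - p * x) <= prim f t.
Proof.
move=> fd fi x0 xy pE xt ty; have d0 : 0 < y - x by rewrite subr_gt0.
have := prim_concave fd fi x0 xt ty; rewrite -(ler_pM2r d0) => H.
rewrite -(ler_pM2r d0).
have E : (p * t + (prim f x - p * x)) * (y - x) =
  prim f x * (y - x) + (t - x) * (p * (y - x)) by ring.
rewrite E pE; have := prim_concave fd fi x0 xt ty; lra.
Qed.

Lemma chord_ge f (p x y t : R) : nonincreasing_pos f -> loc_integrable_pos f ->
  0 <= x -> x < y -> p * (y - x) = prim f y - prim f x -> y <= t ->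
  prim f t <= p * t + (prim f x - p * x).
Proof.
move=> fd fi x0 xy pE yt; have d0 : 0 < y - x by rewrite subr_gt0.
rewrite -(ler_pM2r d0).
have E : (p * t + (prim f x - p * x)) * (y - x) =
  prim f x * (y - x) + (t - x) * (p * (y - x)) by ring.
rewrite E pE; have := prim_concave fd fi x0 (ltW xy) yt; lra.
Qed.

(** The part of the estimate that lies beyond [m]. On [(m, u)] the primitive [F]
    of [f] lies above its chord through [m] and [u], on [(u, 2 m)] below that
    chord, and beyond [2 m] below its chord through [m] and [2 m]. Integrating
    these bounds divided by [t], the constant and linear terms match because
    [(1 + b) u = v] and [b] is the root; what is left is the difference
    of the two slopes times [m (expR b + ln 2 - (2 b + 2))]. *)
Lemma log_part f (b m u v : R) : 0 < b ->
  expR b = (1 + b) * expR (b / (1 + b)) -> expR (b / (1 + b)) < 2 ->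
  2 <= expR b -> 2 * b + 2 <= expR b + ln 2 -> nonincreasing_pos f -> loc_integrable_pos f ->
  loc_integrable_pos (hardy f) -> 0 < m ->
  u = expR (b / (1 + b)) * m -> v = expR b * m ->
  b * (prim f m - prim f (2 * m)) <=
  b * (prim (hardy f) u - prim (hardy f) m) - (prim (hardy f) v - prim (hardy f) u).
Proof.
move=> b0 UV U2 B2 V2 fd fi gi m0 uE vE'; pose S := prim (hardy f).
have a0 : 0 < b / (1 + b) by rewrite divr_gt0//; lra.
have aE : (1 + b) * (b / (1 + b)) = b by field; rewrite gt_eqF//; lra.
set a := b / (1 + b) in uE a0 aE *.
have mu_ : m < u by rewrite uE ltr_pMl// expR_gt1.
have u2 : u < 2 * m by rewrite uE ltr_pM2r.
have vE : v = (1 + b) * u by rewrite vE' UV uE mulrA.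
have u0 : 0 < u by exact: lt_trans mu_.
have v2 : 2 * m <= v by rewrite vE' ler_pM2r.
have lnu : ln u = a + ln m by rewrite uE lnM ?posrE ?expR_gt0// expRK.
have lnv : ln v = b + ln m by rewrite vE' lnM ?posrE ?expR_gt0// expRK.
have ln2m : ln (2 * m) = ln 2 + ln m by rewrite lnM ?posrE.
have um0 : 0 < u - m by rewrite subr_gt0.
have [s1 s1E] : exists s1, s1 * (u - m) = prim f u - prim f m.
  by exists ((prim f u - prim f m) / (u - m)); rewrite divfK ?gt_eqF.
have [s sE] : exists s, s * m = prim f (2 * m) - prim f m.
  by exists ((prim f (2 * m) - prim f m) / m); rewrite divfK ?gt_eqF.
have m2 : m < 2 * m by lra.
have sE' : s * (2 * m - m) = prim f (2 * m) - prim f m by rewrite -sE; ring.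
have m20 : 0 < 2 * m by lra.
have H1 : s1 * (u - m) + (prim f m - s1 * m) * (ln u - ln m) <= S u - S m.
  apply: prim_hardy_ge => //; first exact: ltW.
  move=> t mt tu; exact: (chord_le fd fi (ltW m0) mu_ s1E (ltW mt) (ltW tu)).
have H2 : S (2 * m) - S u <=
    s1 * (2 * m - u) + (prim f m - s1 * m) * (ln (2 * m) - ln u).
  apply: prim_hardy_le => //; first exact: ltW.
  move=> t ut _; exact: (chord_ge fd fi (ltW m0) mu_ s1E (ltW ut)).
have H3 : S v - S (2 * m) <=
    s * (v - 2 * m) + (prim f m - s * m) * (ln v - ln (2 * m)).
  apply: prim_hardy_le => //.
  move=> t mt _; exact: (chord_ge fd fi (ltW m0) m2 sE' (ltW mt)).
have ss1 : 0 <= s1 - s.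
  rewrite subr_ge0 -(ler_pM2r m0) sE.
  by have := chord_ge fd fi (ltW m0) mu_ s1E (ltW u2); lra.
have G : 0 <= (s1 - s) * (m * (expR b + ln 2 - (2 * b + 2))).
  by apply: mulr_ge0 => //; apply: mulr_ge0; [exact: ltW|lra].
have B1 := ler_wpM2l (ltW b0) H1.
rewrite -/S; apply: le_trans (_ : _ <= b * (S u - S m) -
  ((S v - S (2 * m)) + (S (2 * m) - S u))) _; last by lra.
apply: le_trans (lerB B1 (lerD H3 H2)).
rewrite lnu lnv ln2m -subr_ge0.
have -> : prim f (2 * m) = prim f m + s * m by rewrite sE; ring.
set E := (X in 0 <= X).
suff -> : E = (s1 - s) * (m * (expR b + ln 2 - (2 * b + 2))) by [].
have mV : m * expR b = (1 + b) * u by rewrite mulrC -vE' vE.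
have -> : (s1 - s) * (m * (expR b + ln 2 - (2 * b + 2))) =
  (s1 - s) * (m * expR b + m * ln 2 - m * (2 * b + 2)) by ring.
rewrite mV /E vE.
have -> : a = b / (1 + b) by [].
by field; rewrite gt_eqF//; lra.
Qed.

(** With [S] the primitive of [hardy f], the right-hand side is a positive
    multiple of [b S(u) - (S(v) - S(u))], since [v = (1 + b) u]. Below [m],
    [S] is estimated by the monotonicity of [hardy f], beyond [m] by the chords;
    the concavity of the primitive of [f] at [s <= m <= 2 m] concludes. *)
Lemma hardy2_ge f (b m s : R) : 0 < b -> crit b = 0 ->
  nonincreasing_pos f -> loc_integrable_pos f -> loc_integrable_pos (hardy f) ->
  0 < s -> s <= m ->
  forall u v, u = expR (b / (1 + b)) * m -> v = expR b * m ->
  crit_value b * (s / (2 * m) * (hardy f s - hardy f (2 * m))) <=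
  u / v * (hardy (hardy f) u - hardy (hardy f) v).
Proof.
move=> b0 hb fd fi gi s0 sm u v uE vE'.
have m0 : 0 < m := lt_le_trans s0 sm.
have b1 : 0 < 1 + b by lra.
have [U2 B2 V2] := crit_root_exp b0 hb.
have UV := exp_root b0 hb.
have L := log_part b0 UV U2 B2 V2 fd fi gi m0 uE vE'.
have u0 : 0 < u by rewrite uE mulr_gt0// expR_gt0.
have vE : v = (1 + b) * u by rewrite vE' UV uE mulrA.
have v0 : 0 < v by rewrite vE mulr_gt0.
have gd := hardy_nonincreasing fd fi.
have K1 : prim f s <= prim (hardy f) s - prim (hardy f) 0.
  rewrite primE// mulrC -[X in _ * X]subr0; apply: ge_prim_sub => //; first exact: ltW.
  by move=> t t0 /ltW; exact: gd.
have K2 : hardy f m * (m - s) <= prim (hardy f) m - prim (hardy f) s.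
  apply: ge_prim_sub => //; first exact: ltW.
  by move=> t st /ltW; apply: gd; exact: lt_trans st.
have K3 : (m - s) * (prim f (2 * m) - prim f m) <= m * (prim f m - prim f s).
  have := @prim_concave f s m (2 * m) fd fi (ltW s0) sm.
  have -> : 2 * m - m = m by ring.
  by apply; lra.
rewrite prim0 subr0 in K1.
have W0 : 0 < (1 + b) ^+ 2 * u * m by rewrite !mulr_gt0 ?exprn_gt0.
rewrite -(ler_pM2r W0).
have -> : u / v * (hardy (hardy f) u - hardy (hardy f) v) * ((1 + b) ^+ 2 * u * m) =
    m * (b * prim (hardy f) u - (prim (hardy f) v - prim (hardy f) u)).
  by rewrite !primE// vE; field; rewrite !gt_eqF.
have -> : crit_value b * (s / (2 * m) * (hardy f s - hardy f (2 * m))) *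
    ((1 + b) ^+ 2 * u * m) =
    b * (2 * m * prim f s - s * prim f (2 * m)).
  have m20 : 0 < 2 * m by lra.
  rewrite /crit_value expRN UV !primE// uE; field.
  by rewrite !gt_eqF ?expR_gt0.
have mL := ler_wpM2l (ltW m0) L.
have bm0 : 0 <= b * m by rewrite mulr_ge0// ltW.
have bK1 := ler_wpM2l bm0 K1; have bK2 := ler_wpM2l bm0 K2.
have bK3 := ler_wpM2l (ltW b0) K3.
have E : b * m * (hardy f m * (m - s)) = b * (m - s) * prim f m by rewrite primE//; ring.
rewrite E in bK2.
lra.
Qed.

(** With [D = 2 * prim f s - prim f (2 * s)], concavity bounds the left-hand side
    by [D * (t - s) / t ^ 2], while the right-hand side is [D / (4 * s)]. *)
Lemma osc_half_le f (s t : R) : nonincreasing_pos f -> loc_integrable_pos f ->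
  0 < s -> s < t -> t <= 2 * s ->
  s / t * (hardy f s - hardy f t) <= s / (2 * s) * (hardy f s - hardy f (2 * s)).
Proof.
move=> fd fi s0 st ts; have t0 : 0 < t := lt_trans s0 st.
have s20 : 0 < 2 * s by lra.
pose D := 2 * prim f s - prim f (2 * s).
have D0 : 0 <= D.
  have := prim_concave fd fi (lexx 0) (ltW s0) (_ : s <= 2 * s).
  have ss : s <= 2 * s by lra.
  move=> /(_ ss); rewrite prim0 -(ler_pM2l s0).
  have -> : s * ((s - 0) * (prim f (2 * s) - prim f s)) =
    s * s * (prim f s - D) by rewrite /D; ring.
  have -> : s * ((2 * s - s) * (prim f s - 0)) = s * s * prim f s by ring.
  by rewrite ler_pM2l ?mulr_gt0// gerBl.
have C : t * prim f s - s * prim f t <= (t - s) * D.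
  by have := prim_concave fd fi (ltW s0) (ltW st) ts; rewrite /D; lra.
have W : 0 < t ^+ 2 * (4 * s) by rewrite mulr_gt0 ?exprn_gt0//; lra.
rewrite -(ler_pM2r W).
have -> : s / t * (hardy f s - hardy f t) * (t ^+ 2 * (4 * s)) =
    4 * s * (t * prim f s - s * prim f t).
  by rewrite !primE//; field; rewrite gt_eqF.
have -> : s / (2 * s) * (hardy f s - hardy f (2 * s)) * (t ^+ 2 * (4 * s)) =
    t ^+ 2 * D.
  by rewrite /D !primE//; field; rewrite !gt_eqF.
apply: (@le_trans _ _ (4 * s * ((t - s) * D))); first by rewrite ler_wpM2l//; lra.
rewrite mulrA ler_wpM2r// -subr_ge0.
have -> : t ^+ 2 - 4 * s * (t - s) = (t - 2 * s) ^+ 2 by ring.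
exact: sqr_ge0.
Qed.

(** The scale [m] of the extremal interval is the larger of [s] and [t / 2]. *)
Lemma hardy2_ge_osc f (b s t : R) : 0 < b -> crit b = 0 ->
  nonincreasing_pos f -> loc_integrable_pos f -> loc_integrable_pos (hardy f) ->
  0 < s -> s < t -> exists u v, [/\ 0 < u, u <= v &
  crit_value b * (s / t * (hardy f s - hardy f t)) <=
  u / v * (hardy (hardy f) u - hardy (hardy f) v)].
Proof.
move=> b0 hb fd fi gi s0 st.
have bb : b / (1 + b) <= b by rewrite ler_pdivrMr; [rewrite ler_peMr; lra|lra].
have [ts|ts] := leP t (2 * s).
- exists (expR (b / (1 + b)) * s), (expR b * s); split.
  + by rewrite mulr_gt0// expR_gt0.
  + by rewrite ler_pM2r// ler_expR.
  + apply: le_trans (hardy2_ge b0 hb fd fi gi s0 (lexx s) (erefl _) (erefl _)).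
    by rewrite ler_pM2l ?crit_value_gt0// osc_half_le.
- have s2 : s <= t / 2 by lra.
  have t2 : 0 < t / 2 by lra.
  exists (expR (b / (1 + b)) * (t / 2)), (expR b * (t / 2)); split.
  + by rewrite mulr_gt0// expR_gt0.
  + by rewrite ler_pM2r// ler_expR.
  + apply: le_trans (hardy2_ge b0 hb fd fi gi s0 s2 (erefl _) (erefl _)).
    by have -> : 2 * (t / 2) = t by field.
Qed.

Lemma bmo_hardy_ge f (b : R) : 0 < b -> crit b = 0 ->
  nonincreasing_pos f -> loc_integrable_pos f ->
  ((crit_value b)%:E * bmo f <= bmo (hardy f))%E.
Proof.
move=> b0 hb fd fi; have c0 := crit_value_gt0 b0.
have [gi|ngi] := pselect (loc_integrable_pos (hardy f)); last first.
  by rewrite [bmo (hardy f)]/bmo; case: asboolP => // _; rewrite leey.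
have lower u v := @bmo_ge (hardy f) u v gi.
case: (bmo (hardy f)) lower => [r| |] lower; last 2 first.
- by rewrite leey.
- by have := lower 1 1 ltr01 (lexx 1); rewrite leeNy_eq.
have rE : r%:E = ((crit_value b)%:E * (2 * (r / (2 * crit_value b)))%:E)%E.
  by rewrite -EFinM; congr EFin; field; rewrite gt_eqF.
rewrite rE; apply: lee_wpmul2l; first by rewrite lee_fin ltW.
apply: bmo_le => // s t s0 st.
have [u [v [u0 uv H]]] := hardy2_ge_osc b0 hb fd fi gi s0 st.
have := lower u v u0 uv; rewrite lee_fin => Hr.
have c20 : 0 < 2 * crit_value b by lra.
by rewrite ler_pdivlMr//; lra.
Qed.

(** * The indicator of (0, 1) *)

Lemma chi01E (t : R) : 0 < t -> chi01 t = (t < 1)%R%:R.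
Proof.
move=> t0; rewrite /chi01 indicE; congr (_%:R : R); congr nat_of_bool.
by apply/idP/idP; rewrite inE /= in_itv /= t0.
Qed.

Lemma loc_integrable_posP f :
  (forall N : R, 0 < N -> mu.-integrable `]0, N[ (EFin \o f)) -> loc_integrable_pos f.
Proof.
move=> H I HI; have [N N0 IN] := bounded_interval_pos_sub HI.
have mI := bounded_interval_pos_measurable HI.
by apply: (@integrableS _ _ _ mu `]0, N[) => //; exact: H.
Qed.

Lemma chi01_nonincreasing : nonincreasing_pos (@chi01 R).
Proof.
move=> x y x0 xy; rewrite !chi01E ?(lt_le_trans x0 xy)// ler_nat.
by case: (ltP y 1) => // y1; rewrite (le_lt_trans xy y1).
Qed.

Lemma chi01_loc_integrable : loc_integrable_pos (@chi01 R).
Proof.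
apply: loc_integrable_posP => N N0.
have := @integrable_indic_itv R 0 1 false true; apply: integrableS => //.
Qed.

Lemma prim_chi01 (x : R) : 0 <= x -> prim (@chi01 R) x = Num.min x 1.
Proof.
have le1 (y : R) : 0 <= y -> y <= 1 -> prim (@chi01 R) y = y.
  move=> y0 y1; rewrite -[RHS]subr0 -[RHS]mul1r -Rintegral_cst_oo//.
  apply: eq_Rintegral => t /set_mem /=; rewrite in_itv /= => /andP[t0 ty].
  by rewrite chi01E// (lt_le_trans ty y1).
move=> x0; case: (leP x 1) => [x1|x1]; first exact: le1.
have := Rintegral_prim chi01_loc_integrable (@ler01 R) (ltW x1).
rewrite (le1 1)//; move/eqP; rewrite eq_sym subr_eq => /eqP ->.
rewrite -[RHS]add0r; congr (_ + _).
have -> : 0 = 0 * (x - 1) :> R by rewrite mul0r.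
rewrite -Rintegral_cst_oo ?(ltW x1)//.
apply: eq_Rintegral => t /set_mem /=; rewrite in_itv /= => /andP[t1 _].
by rewrite chi01E ?(lt_trans _ t1)// ltNge (ltW t1).
Qed.

Lemma hardy_chi01_le1 (x : R) : 0 < x -> x <= 1 -> hardy (@chi01 R) x = 1.
Proof.
move=> x0 x1; rewrite /hardy -/(prim (@chi01 R) x) prim_chi01 ?ltW//.
by rewrite min_l// mulVf// gt_eqF.
Qed.

Lemma hardy_chi01_ge1 (x : R) : 1 <= x -> hardy (@chi01 R) x = x^-1.
Proof.
move=> x1; rewrite /hardy -/(prim (@chi01 R) x) prim_chi01 ?(le_trans ler01)//.
by rewrite min_r// mulr1.
Qed.

Lemma hardy_chi01_nonincreasing : nonincreasing_pos (hardy (@chi01 R)).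
Proof. exact: hardy_nonincreasing chi01_nonincreasing chi01_loc_integrable. Qed.

Lemma hardy_chi01_loc_integrable : loc_integrable_pos (hardy (@chi01 R)).
Proof.
apply: loc_integrable_posP => N N0.
have cM : continuous (fun t : R => (Num.max t 1)^-1).
  move=> t; apply: cvgV; first by rewrite gt_eqF// lt_max ltr01 orbT.
  by apply: continuous_max; [exact: cvg_id|exact: cvg_cst].
have iM : mu.-integrable `]0, N[ (EFin \o (fun t : R => (Num.max t 1)^-1)).
  apply: (@integrableS _ _ _ mu `[0, N]) => //; first exact: subset_itv_oo_cc.
  apply: continuous_compact_integrable; first exact: segment_compact.
  exact: continuous_subspaceT.
apply: eq_integrable iM => // t /set_mem /=; rewrite in_itv /= => /andP[t0 _].
congr EFin; case: (leP t 1) => t1; first by rewrite hardy_chi01_le1// invr1.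
by rewrite hardy_chi01_ge1// ltW.
Qed.

Lemma prim_hardy_chi01_le1 (x : R) : 0 < x -> x <= 1 ->
  prim (hardy (@chi01 R)) x = x.
Proof.
move=> x0 x1; rewrite -[RHS]subr0 -[RHS]mul1r -Rintegral_cst_oo ?ltW//.
apply: eq_Rintegral => t /set_mem /=; rewrite in_itv /= => /andP[t0 tx].
by rewrite hardy_chi01_le1// ltW// (lt_le_trans tx x1).
Qed.

Lemma prim_hardy_chi01_ge1 (x : R) : 1 <= x ->
  prim (hardy (@chi01 R)) x = 1 + ln x.
Proof.
move=> x1; have := Rintegral_prim hardy_chi01_loc_integrable (@ler01 R) x1.
rewrite (@prim_hardy_chi01_le1 1)//; move/eqP; rewrite eq_sym subr_eq => /eqP ->.
rewrite addrC; congr (_ + _).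
have := @Rintegral_affine_inv 0 1 1 x ltr01 x1; rewrite mul0r add0r ln1 subr0 mul1r => <-.
apply: eq_Rintegral => t /set_mem /=; rewrite in_itv /= => /andP[t1 _].
by rewrite hardy_chi01_ge1 ?(ltW t1)// add0r mul1r.
Qed.

(** The oscillation of the indicator over [(0, t)], [t > 1], is [2 (t - 1) / t ^ 2],
    largest at [t = 2]. *)
Lemma bmo_chi01 : bmo (@chi01 R) = (2^-1)%:E.
Proof.
have fi := chi01_loc_integrable; have fd := chi01_nonincreasing.
apply/eqP; rewrite eq_le; apply/andP; split.
  have -> : 2^-1 = 2 * (4^-1) :> R by field.
  apply: bmo_le => // s t s0 st; have t0 : 0 < t := lt_trans s0 st.
  have [t1|t1] := leP t 1.
    rewrite !hardy_chi01_le1 ?(le_trans (ltW st))//.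
    by rewrite subrr mulr0 invr_ge0.
  have W : 0 < 4 * t ^+ 2 by rewrite mulr_gt0// exprn_gt0.
  have S : 0 <= (t - 2) ^+ 2 by exact: sqr_ge0.
  rewrite -(ler_pM2r W) [hardy _ t]hardy_chi01_ge1 ?(ltW t1)//.
  have -> : 4^-1 * (4 * t ^+ 2) = t ^+ 2 by field.
  have [s1|s1] := leP s 1.
    rewrite hardy_chi01_le1//.
    have -> : s / t * (1 - t^-1) * (4 * t ^+ 2) = 4 * s * (t - 1).
      by field; rewrite gt_eqF.
    have : 0 <= (1 - s) * (t - 1) by rewrite mulr_ge0; lra.
    by move: S; rewrite !expr2; lra.
  rewrite hardy_chi01_ge1 ?(ltW s1)//.
  have -> : s / t * (s^-1 - t^-1) * (4 * t ^+ 2) = 4 * (t - s).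
    by field; rewrite !gt_eqF.
  by move: S; rewrite !expr2; lra.
have := bmo_ge fi (@ltr01 R) (ler1n R 2); apply: le_trans.
rewrite hardy_chi01_le1// hardy_chi01_ge1 ?ler1n// lee_fin; lra.
Qed.

(** The lower bound is the general inequality applied to the indicator. For the
    upper bound, [H (H chi)] is [(1 + ln x) / x] beyond 1; with [t = expR y] fixed,
    [1 + z <= expR z] gives the maximum over [s], which is
    [(y - ln (1 + y)) * expR (- y)], and the root of [crit] maximizes the latter. *)
Lemma bmo_hardy_chi01 (b : R) : 0 < b -> crit b = 0 ->
  bmo (hardy (@chi01 R)) = (crit_value b / 2)%:E.
Proof.
move=> b0 hb; have fi := chi01_loc_integrable; have fd := chi01_nonincreasing.
have gi := hardy_chi01_loc_integrable; have gd := hardy_chi01_nonincreasing.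
have c0 := crit_value_gt0 b0.
apply/eqP; rewrite eq_le; apply/andP; split; last first.
  by have := bmo_hardy_ge b0 hb fd fi; rewrite bmo_chi01 -EFinM.
have -> : crit_value b / 2 = 2 * (crit_value b / 4) by field.
(* the case of a left endpoint in the region where the function is not constant *)
have main s t : 1 <= s -> s < t ->
    s / t * ((1 + ln s) / s - (1 + ln t) / t) <= crit_value b / 4.
  move=> s1 st; have s0 : 0 < s := lt_le_trans ltr01 s1.
  have t0 : 0 < t := lt_trans s0 st.
  set y := ln t; have y0 : 0 < y by rewrite ln_gt0// (le_lt_trans s1).
  have tE : t = expR y by rewrite /y lnK.
  set x := ln s; have sE : s = expR x by rewrite /x lnK.
  have y1 : 0 < 1 + y by lra.
  have P := profile_le b0 hb (ltW y0).
  have -> : crit_value b / 4 = b / (1 + b) * expR (- b).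
    by rewrite /crit_value; field; rewrite gt_eqF//; lra.
  apply: le_trans P; rewrite expRN -tE.
  have -> : s / t * ((1 + x) / s - (1 + y) / t) = ((1 + x) - (1 + y) * s / t) / t.
    by field; rewrite !gt_eqF.
  rewrite ler_pM2r ?invr_gt0//.
  have : 1 + (x + ln (1 + y) - y) <= (1 + y) * s / t.
    have -> : (1 + y) * s / t = expR (x + ln (1 + y) - y).
      by rewrite expRB expRD lnK ?posrE// -sE -tE [s * _]mulrC.
    exact: expR_ge1Dx.
  lra.
apply: bmo_le => // s t s0 st; have t0 : 0 < t := lt_trans s0 st.
have hE (x : R) : 1 <= x -> hardy (hardy (@chi01 R)) x = (1 + ln x) / x.
  by move=> x1; rewrite {1}/hardy -/(prim _ _) prim_hardy_chi01_ge1// mulrC.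
have hE1 (x : R) : 0 < x -> x <= 1 -> hardy (hardy (@chi01 R)) x = 1.
  by move=> x0 x1; rewrite {1}/hardy -/(prim _ _) prim_hardy_chi01_le1// mulVf// gt_eqF.
have [s1|s1] := leP 1 s; first by rewrite !hE ?(ltW (le_lt_trans s1 st))//; exact: main.
have [t1|t1] := leP t 1.
  by rewrite !hE1 ?(ltW s1)// subrr mulr0 divr_ge0// ltW.
have M := main 1 t (lexx 1) t1.
rewrite ln1 addr0 divr1 -hE ?(ltW t1)// in M.
rewrite hE1 ?(ltW s1)//; apply: le_trans M; apply: ler_wpM2r.
  rewrite subr_ge0 -(@hE1 1)//.
  by apply: hardy_nonincreasing => //; exact: ltW.
by rewrite ler_pM2r ?invr_gt0// ltW.
Qed.

(** * The constant *)

Lemma alpha0E (b : R) : 0 < b -> crit b = 0 -> alpha0 R = (crit_value b)%:E.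
Proof.
move=> b0 hb; rewrite /alpha0 (bmo_hardy_chi01 b0 hb) bmo_chi01.
rewrite inver ifF; last by apply/negbTE; rewrite invr_eq0.
by rewrite -EFinM invrK divfK.
Qed.

Lemma gamma_eqP (g : R) : 1 < g -> gamma_eq g <-> crit (ln g) = 0.
Proof.
move=> g1; have g0 : 0 < g by exact: lt_trans g1.
have lg : 0 < ln g by rewrite ln_gt0.
rewrite /gamma_eq ln_div ?posrE//; last by lra.
by rewrite /crit; split; lra.
Qed.

End HardyBMO.

Theorem theorem1p1 (R : realType) :
  [/\ (forall f : R -> R,
         (forall x y : R, 0 < x -> x <= y -> f y <= f x) ->
         loc_integrable_pos f ->
         (alpha0 R * bmo f <= bmo (hardy f))%E),
      (forall c : R, (alpha0 R < c%:E)%E ->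
         exists f : R -> R,
           [/\ (forall x y : R, 0 < x -> x <= y -> f y <= f x),
               loc_integrable_pos f
             & (bmo (hardy f) < c%:E * bmo f)%E]),
      (exists! gamma1 : R, 1 < gamma1 /\ gamma_eq gamma1)
    & (forall gamma1 : R, 1 < gamma1 -> gamma_eq gamma1 ->
         alpha0 R = (4 * ln gamma1 / (gamma1 * (1 + ln gamma1)))%:E /\
         `|4 * ln gamma1 / (gamma1 * (1 + ln gamma1))
            - (5212 / 10 ^+ 4 + 3637 / 10 ^+ 8)| < 2 / 10 ^+ 8)].
Proof.
have [b [b0 hb]] := @crit_root_exists R; have aE := alpha0E b0 hb.
split.
- by move=> f fd fi; rewrite aE; exact: bmo_hardy_ge.
- move=> c; rewrite aE lte_fin => bc; exists (@chi01 R); split.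
  + exact: chi01_nonincreasing.
  + exact: chi01_loc_integrable.
  + by rewrite (bmo_hardy_chi01 b0 hb) bmo_chi01 -EFinM lte_fin ltr_pM2r.
- have eb1 : 1 < expR b by rewrite expR_gt1.
  exists (expR b); split; first by split => //; apply/gamma_eqP; rewrite ?expRK.
  move=> g [g1 /(gamma_eqP g1) hg].
  by rewrite (crit_uniq b0 (ln_gt0 g1) hb hg) lnK// posrE (lt_trans ltr01).
- move=> g g1 /(gamma_eqP g1) hg; have lg := ln_gt0 g1.
  have g0 : 0 < g by exact: lt_trans g1.
  have vE : 4 * ln g / (g * (1 + ln g)) = crit_value (ln g).
    by rewrite /crit_value expRN lnK ?posrE//; field; rewrite !gt_eqF//; lra.
  rewrite vE; split; first exact: alpha0E.
  exact: crit_value_approx.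
Qed.
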